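(* For each integer $n\ge 4$, $$\psi_2(n)=\psi_{n-2}(n)=1+\left\lfloor\frac{n-2}{2}\right\rfloor.$$
   Context: The wheel $W_n$ is the join of the cycle $C_n$ (the outer cycle) and a single vertex: $V(W_n)=\{v,v_1,\dots,v_n\}$ and $E(W_n)=\{vv_i,\ v_iv_{i+1} : 1\le i\le n\}$ with subscripts modulo $n$; the outer cycle $C_n$ has edges $v_iv_{i+1}$. A signed graph $\Sigma=(G,\sigma)$ is a graph $G$ together with a function $\sigma:E(G)\to\{+1,-1\}$; an edge $e$ is negative if $\sigma(e)=-1$. Switching $\Sigma$ at a vertex $u$ changes the sign of every edge incident to $u$. Two signed graphs are isomorphic if there is a graph isomorphism between their underlying graphs preserving edge signs. Two signed graphs are switching isomorphic if one is isomorphic to a signed graph obtained from the other by a sequence of switchings. $(W_n,\sigma)^o$ denotes a signed wheel all of whose negative edges lie on the outer cycle $C_n$. For $0\le p\le n$, $\psi_p(n)$ denotes the number of switching non-isomorphic signed wheels of the form $(W_n,\sigma)^o$ with exactly $p$ negative edges (the number of equivalence classes of such signed wheels under switching isomorphism). *)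

(* Defs.v *)
From HB Require Import structures.
From mathcomp Require Import all_boot fingroup perm.

Set Implicit Arguments.
Unset Strict Implicit.
Unset Printing Implicit Defensive.

Section SignedGraphs.

(* A simple graph on V is given by its set E of edges, each edge being the set
   of its two endpoints. *)
Variables (V : finType) (E : {set {set V}}).

Definition edge := {e : {set V} | e \in E}.

(* A signed graph with underlying graph (V, E): [true] stands for the sign -1
   and [false] for +1, so the product of signs is [addb]. *)
Definition signature := {ffun edge -> bool}.

Definition negative_edges (s : signature) : {set edge} := [set e | s e].

Definition switch (u : V) (s : signature) : signature :=
  [ffun e : edge => (u \in val e) (+) s e].

Definition switch_step : rel signature :=
  [rel s t | [exists u, t == switch u s]].

Definition switching_equivalent : rel signature := connect switch_step.

Definition graph_automorphism (f : {perm V}) : bool :=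
  [set f @: (e : {set V}) | e in E] == E.

Definition sign_preserving (f : {perm V}) (s t : signature) : bool :=
  [forall e : edge, forall e' : edge,
     (val e' == f @: val e) ==> (t e' == s e)].

Definition isomorphic : rel signature :=
  [rel s t | [exists f : {perm V},
     graph_automorphism f && sign_preserving f s t]].

Definition switching_isomorphic : rel signature :=
  [rel s t | [exists s' : signature,
     switching_equivalent s s' && isomorphic s' t]].

Lemma switchK (u : V) : involutive (switch u).
Proof. by move=> s; apply/ffunP=> e; rewrite !ffunE addKb. Qed.

Lemma switching_equivalent_sym : symmetric switching_equivalent.
Proof.
apply: sym_connect_sym => s t.
by apply/existsP/existsP=> -[u /eqP->]; exists u; rewrite switchK.
Qed.

Lemma isomorphicP (s t : signature) :
  reflect (exists2 f : {perm V}, graph_automorphism f &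
             forall e e' : edge, val e' = f @: val e -> t e' = s e)
          (isomorphic s t).
Proof.
apply: (iffP existsP) => [[f /andP[fE fst]]|[f fE fst]]; exists f => //.
  move=> e e' ee'; move/forallP/(_ e)/forallP/(_ e')/implyP: fst => fst.
  by apply/eqP/fst/eqP.
rewrite fE; apply/forallP=> e; apply/forallP=> e'.
by apply/implyP=> /eqP/fst/eqP.
Qed.

Lemma graph_automorphism_edge f (e : edge) :
  graph_automorphism f -> exists e' : edge, val e' = f @: val e.
Proof.
move=> /eqP fE.
have fe : f @: val e \in E.
  have: f @: val e \in [set f @: (A : {set V}) | A in E] by exact/imset_f/(valP e).
  by rewrite fE.
by exists (Sub (f @: val e) fe).
Qed.

Lemma graph_automorphismV f :
  graph_automorphism f -> graph_automorphism f^-1%g.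
Proof.
move=> /eqP fE; apply/eqP; rewrite -[in LHS]fE -imset_comp.
rewrite -[RHS]imset_id; apply: eq_imset => e /=.
by rewrite -imset_comp -[RHS]imset_id; apply: eq_imset => x /=; rewrite permK.
Qed.

Lemma graph_automorphismM f g :
  graph_automorphism f -> graph_automorphism g -> graph_automorphism (f * g)%g.
Proof.
move=> /eqP fE /eqP gE; apply/eqP; rewrite -[RHS]gE -[in RHS]fE -imset_comp.
apply: eq_imset => e /=; rewrite -imset_comp.
by apply: eq_imset => x; rewrite permM.
Qed.

Lemma isomorphic_refl : reflexive isomorphic.
Proof.
move=> s; apply/isomorphicP.
have id1 (A : {set V}) : (1%g : {perm V}) @: A = A.
  by rewrite -[RHS]imset_id; apply: eq_imset => x; rewrite perm1.
exists 1%g => [|e e']; last by rewrite id1 => /val_inj->.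
by apply/eqP; rewrite -[RHS]imset_id; apply: eq_imset.
Qed.

Lemma isomorphic_sym : symmetric isomorphic.
Proof.
suff imp (s t : signature) : isomorphic s t -> isomorphic t s by move=> s t; apply/idP/idP; apply: imp.
move=> /isomorphicP[f fE fst]; apply/isomorphicP.
exists f^-1%g => [|e e' ee']; first exact: graph_automorphismV.
apply/esym/fst; rewrite ee' -imset_comp -[LHS]imset_id.
by apply: eq_imset => x /=; rewrite permKV.
Qed.

Lemma isomorphic_trans : transitive isomorphic.
Proof.
move=> t s r /isomorphicP[f fE fst] /isomorphicP[g gE gtr]; apply/isomorphicP.
exists (f * g)%g => [|e e' ee']; first exact: graph_automorphismM.
have [e1 ee1] := graph_automorphism_edge e fE.
rewrite -(fst _ _ ee1); apply: gtr; rewrite ee' ee1 -imset_comp.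
by apply: eq_imset => x; rewrite permM.
Qed.

Lemma isomorphic_switch (s t : signature) (u : V) :
  isomorphic s t -> exists u', isomorphic (switch u s) (switch u' t).
Proof.
move=> /isomorphicP[f fE fst]; exists (f u); apply/isomorphicP; exists f => //.
move=> e e' ee'; rewrite !ffunE (fst _ _ ee') ee' mem_imset //.
exact: perm_inj.
Qed.

Lemma isomorphic_switching_equivalent (s s' t : signature) :
    isomorphic s t -> switching_equivalent s s' ->
  exists2 t', isomorphic s' t' & switching_equivalent t t'.
Proof.
move=> st /connectP[p]; elim: p s t st => [|s1 p IHp] s t st /=.
  by move=> _ ->; exists t => //; apply: connect0.
case/andP=> /existsP[u /eqP->] ps1 s'E.
have [u' st1] := isomorphic_switch u st.
have [t' ? tt'] := IHp _ _ st1 ps1 s'E; exists t' => //.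
by apply: connect_trans tt'; apply/connect1/existsP; exists u'.
Qed.

(* This legitimizes the use of [equivalence_partition] below. *)
Lemma switching_isomorphic_equivalence : equivalence_rel switching_isomorphic.
Proof.
have refl : reflexive switching_isomorphic.
  by move=> s; apply/existsP; exists s; rewrite isomorphic_refl andbT; apply: connect0.
have sym (s t : signature) : switching_isomorphic s t -> switching_isomorphic t s.
  case/existsP=> s' /andP[ss' s't].
  have s's : switching_equivalent s' s by rewrite switching_equivalent_sym.
  have [t' st' tt'] := isomorphic_switching_equivalent s't s's.
  by apply/existsP; exists t'; rewrite tt' isomorphic_sym.
have trans : transitive switching_isomorphic.
  move=> t s r /existsP[s' /andP[ss' s't]] /existsP[t' /andP[tt' t'r]].
  move: (s't); rewrite isomorphic_sym => ts'.
  have [s1 t's1 s's1] := isomorphic_switching_equivalent ts' tt'.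
  apply/existsP; exists s1; apply/andP; split; first exact: connect_trans s's1.
  by apply: isomorphic_trans t'r; rewrite isomorphic_sym.
move=> s t r; split=> // st.
by apply/idP/idP; apply: trans => //; apply: sym.
Qed.

End SignedGraphs.

(* The vertices of the wheel W_n: [None] is the hub v and the [Some i] are the
   rim vertices v_i, indexed by residues mod n ([ordS i] is i + 1 mod n).  For
   n < 3 this is not a wheel, as the rim degenerates. *)
Definition wheel_vertex (n : nat) := option 'I_n.

Definition spokes (n : nat) : {set {set wheel_vertex n}} :=
  [set [set None; Some i] | i : 'I_n].

Definition outer_cycle (n : nat) : {set {set wheel_vertex n}} :=
  [set [set Some i; Some (ordS i)] | i : 'I_n].

Definition wheel (n : nat) : {set {set wheel_vertex n}} :=
  spokes n :|: outer_cycle n.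

(* The signed wheels (W_n, s)^o. *)
Definition rim_signed (n : nat) (s : signature (wheel n)) : bool :=
  [forall e in negative_edges s, val e \in outer_cycle n].

Definition rim_signed_wheels (p n : nat) : {set signature (wheel n)} :=
  [set s | rim_signed s & #|negative_edges s| == p].

Definition psi (p n : nat) : nat :=
  #|equivalence_partition (@switching_isomorphic _ (wheel n))
      (rim_signed_wheels p n)|.

(* Main.v *)
Require Import Defs.
From mathcomp Require Import all_boot fingroup perm ssralg zmodp zify ring.

Set Implicit Arguments.
Unset Strict Implicit.
Unset Printing Implicit Defensive.

Import GRing.Theory.

(** The sign of a rim edge is the sign of the triangle it spans with the hub as
    soon as the spokes are positive, and signs of triangles are invariant under
    switching.  For [n >= 4] every automorphism of the wheel fixes the hub, hence
    acts on the rim as a rotation or a reflection.  So two rim-signed wheels are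
    switching isomorphic iff their sets of negative rim edges are congruent
    modulo the dihedral group.  A pair of rim edges, or the complement of one,
    is classified by its cyclic distance, which lies between [1] and [n./2]. *)

(** The family [c] is a transversal of the classes, so [k] goes bijectively to the class of
    [c k]. *)
Lemma card_equivalence_partition_repr (T I : finType) (R : rel T) (D : {set T})
    (c : I -> T) :
    equivalence_rel R -> (forall k, c k \in D) ->
    (forall x, x \in D -> exists k, R x (c k)) ->
    (forall k l, R (c k) (c l) -> k = l) ->
  #|equivalence_partition R D| = #|I|.
Proof.
move=> eqR cD cover cinj.
pose cls x := [set y in D | R x y].
have -> : equivalence_partition R D = [set cls (c k) | k : I].
  apply/setP=> B; apply/imsetP/imsetP=> [[x xD ->]|[k _ ->]]; last by exists (c k).
  have [k xk] := cover x xD; exists k => //.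
  by apply/setP=> y; rewrite !inE ((eqR x (c k) y).2 xk).
rewrite card_imset ?cardsT // => k l /setP/(_ (c l)).
by rewrite !inE cD (eqR (c l) (c l) (c l)).1 /= => /cinj.
Qed.

Lemma eq_set2 (T : finType) (a b c d : T) :
  [set a; b] = [set c; d] -> (a = c /\ b = d) \/ (a = d /\ b = c).
Proof.
move=> E.
have : a \in [set c; d] by rewrite -E set21.
have : b \in [set c; d] by rewrite -E set22.
have : c \in [set a; b] by rewrite E set21.
have : d \in [set a; b] by rewrite E set22.
rewrite !inE.
by do 4![case/orP=> /eqP ?]; subst; auto.
Qed.

Lemma imset_set2 (T U : finType) (f : T -> U) x y :
  f @: [set x; y] = [set f x; f y].
Proof. by rewrite imsetU1 imset_set1. Qed.

(** Two distances that are at most [n./2] and add up to [n] are both half of [n]. This settles the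
    reflected case when representatives are compared. *)
Lemma half_sub_eq n p q : p < n./2 -> q < n./2 -> p.+1 = n - q.+1 -> p = q.
Proof. lia. Qed.

Section Wheel.

(** * Edges of the wheel, adjacency on the rim, signs of triangles *)

Variable m : nat.
(** The form [m.+4] encodes [n >= 4] and gives ['I_n] the ring structure of residues mod [n]. *)
Let n := m.+4.
Implicit Types (i j : 'I_n) (k l : 'I_n./2) (s t : signature (wheel n)) (b : bool).

Local Open Scope ring_scope.

Lemma ordSE i : ordS i = i + 1.
Proof. by apply: val_inj; rewrite /= modnDmr addn1. Qed.

Lemma spoke_subproof i : [set None; Some i] \in wheel n.
Proof. by rewrite in_setU; apply/orP; left; apply: imset_f. Qed.

Lemma rim_subproof i : [set Some i; Some (i + 1)] \in wheel n.
Proof. by rewrite in_setU -ordSE; apply/orP; right; apply: (imset_f (fun i : 'I_n => [set Some i; Some (ordS i)])). Qed.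

Definition spoke i : edge (wheel n) := exist (fun A => A \in wheel n) _ (spoke_subproof i).
Definition rim i : edge (wheel n) := exist (fun A => A \in wheel n) _ (rim_subproof i).

Lemma val_rim i : val (rim i) = [set Some i; Some (i + 1)]. Proof. by []. Qed.

Lemma wheel_edgeP (e : edge (wheel n)) :
  (exists i, e = spoke i) \/ (exists i, e = rim i).
Proof.
have := valP e; rewrite in_setU => /orP[] /imsetP[i _ ei].
  by left; exists i; apply: val_inj.
by right; exists i; apply: val_inj; rewrite ei ordSE.
Qed.

Lemma addr1_neq i : i + 1 <> i.
Proof. by move/(congr1 (+%R (- i))); rewrite addKr addNr => /(congr1 val). Qed.

Lemma addr2_neq i : i + 1 + 1 <> i.
Proof. by rewrite -addrA => /(congr1 (+%R (- i))); rewrite addKr addNr => /(congr1 val). Qed.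

Lemma addr3_neq i : i + 1 + 1 + 1 <> i.
Proof. by rewrite -!addrA => /(congr1 (+%R (- i))); rewrite addKr addNr => /(congr1 val). Qed.

Lemma rim_inj : injective rim.
Proof.
move=> i j /(congr1 val) /eq_set2[[[]//]|[[->] []]].
by move/addr2_neq.
Qed.

Lemma rim_adjacent i j :
  [set Some i; Some j] \in wheel n -> j = i + 1 \/ i = j + 1.
Proof.
move=> ijE; case: (wheel_edgeP (exist (fun A => A \in wheel n) _ ijE)) => -[k /(congr1 val)] /= /eq_set2.
  by case=> -[].
by case=> -[[->] [->]]; auto.
Qed.

(** Switching at a corner of the triangle flips exactly two of its edges, and at any other vertex
    none. *)
Lemma triangle_switching_equivalent s t i : switching_equivalent s t ->
  t (spoke i) (+) t (spoke (i + 1)) (+) t (rim i)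
    = s (spoke i) (+) s (spoke (i + 1)) (+) s (rim i).
Proof.
case/connectP=> p; elim: p s => [|s1 p IHp] s /=; first by move=> _ ->.
case/andP=> /existsP[u /eqP s1E] p1 tE; rewrite (IHp s1 p1 tE) s1E {s1E} !ffunE !inE.
have : ~~ ((u == Some i) && (u == Some (i + 1))).
  by apply/negP=> /andP[/eqP->] /eqP[/esym/addr1_neq].
case: u => [u|] /=; last by case: (s _) (s _) (s _) => [] [] [].
rewrite !(inj_eq Some_inj).
by case: (u == i); case: (u == i + 1);
  case: (s _) => //; case: (s _) => //; case: (s _).
Qed.

Lemma rim_signedP s : reflect (forall i, s (spoke i) = false) (rim_signed s).
Proof.
apply: (iffP forall_inP) => [sP i|sP e].
  apply/negP=> si; have := sP (spoke i); rewrite inE => /(_ si).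
  by case/imsetP=> j _ /eq_set2[] [].
case: (wheel_edgeP e) => -[i ->]; rewrite inE ?sP // => _.
rewrite val_rim -ordSE; exact: (imset_f (fun i : 'I_n => [set Some i; Some (ordS i)])).
Qed.

(** * Automorphisms of the wheel and their action on rim signs *)

Lemma automorphism_edge (f : {perm wheel_vertex n}) x y :
    graph_automorphism (wheel n) f ->
  [set x; y] \in wheel n -> [set f x; f y] \in wheel n.
Proof. by move=> /eqP fE xyE; rewrite -[wheel n]fE -imset_set2; exact: imset_f. Qed.

(* Only the hub is adjacent to all other vertices, because [i + 2] is
   not a neighbour of [i] when [n >= 4]. *)
Lemma automorphism_hub (f : {perm wheel_vertex n}) :
  graph_automorphism (wheel n) f -> f None = None.
Proof.
move=> fE; case fN: (f None) => [i|//]; exfalso.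
have adj j : j != i -> [set Some i; Some j] \in wheel n.
  move=> ji; have [z zj] : exists z, f z = Some j by exists (f^-1%g (Some j)); rewrite permKV.
  case: z zj => [z zj|]; last by rewrite fN => -[] /esym/eqP; rewrite (negPf ji).
  by rewrite -fN -zj; apply: automorphism_edge fE _; exact: spoke_subproof.
have /adj/rim_adjacent[] : i + 1 + 1 != i by apply/eqP/addr2_neq.
  by move/addr1_neq.
by move/esym/addr3_neq.
Qed.

Lemma automorphism_rim (f : {perm wheel_vertex n}) :
    graph_automorphism (wheel n) f ->
  exists2 g : 'I_n -> 'I_n, forall i, f (Some i) = Some (g i) &
    (forall i, g (i + 1) = g i + 1) \/ (forall i, g i = g (i + 1) + 1).
Proof.
move=> fE; have fN := automorphism_hub fE.
(* The default is never reached, since only the hub is sent to [None]. *)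
pose g i := odflt i (f (Some i)).
have gP i : f (Some i) = Some (g i).
  rewrite /g; case fi: (f (Some i)) => //.
  by have := perm_inj (etrans fi (esym fN)).
have ginj : injective g by move=> i j gij; apply/Some_inj/(@perm_inj _ f); rewrite !gP gij.
exists g => //.
have step i : g (i + 1) = g i + 1 \/ g i = g (i + 1) + 1.
  by apply: rim_adjacent; rewrite -!gP; apply: automorphism_edge fE (rim_subproof i).
(* Turning back at [i + 1] would give [g (i + 1 + 1) = g i], against injectivity. The direction at
   one index thus spreads around the whole rim. *)
have up i : g (i + 1) = g i + 1 -> g (i + 1 + 1) = g (i + 1) + 1.
  move=> gi; case: (step (i + 1)) => // /eqP.
  by rewrite gi (inj_eq (addIr 1)) => /eqP/ginj/esym/addr2_neq.
have up_all i : g (i + 1) = g i + 1 -> forall j, g (j + 1) = g j + 1.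
  move=> gi j; suff IH (p : nat) : g (i + p%:R + 1) = g (i + p%:R) + 1.
    by rewrite -(subrKC i j) -(natr_Zp (j - i)) IH.
  elim: p => [|p IHp]; first by rewrite addr0.
  by rewrite -natr1 addrA; apply: up.
case: (step 0) => [/up_all|g0]; [by left | right=> i].
case: (step i) => // /up_all/(_ 0) gS.
by move: g0; rewrite gS => /esym/addr2_neq.
Qed.

(** The switched signature [s'] has positive spokes because [f] maps them to spokes of [t]; by
    invariance of triangle signs it then agrees with [s] on the rim. *)
Lemma switching_isomorphic_rim s t :
    rim_signed s -> rim_signed t -> switching_isomorphic s t ->
  exists2 g : 'I_n -> 'I_n, forall i, t (rim (g i)) = s (rim i) &
    (forall i j, g i - g j = i - j) \/ (forall i j, g i - g j = j - i).
Proof.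
move=> /rim_signedP s0 /rim_signedP t0 /existsP[s' /andP[ss' /isomorphicP[f fE fst]]].
have fN := automorphism_hub fE.
have [g gP gS] := automorphism_rim fE.
have s'0 i : s' (spoke i) = false.
  rewrite -(fst (spoke i) (spoke (g i))) //=.
  by rewrite imset_set2 fN gP.
have s'rim i : s' (rim i) = s (rim i).
  by have := triangle_switching_equivalent i ss'; rewrite !s'0 !s0.
have frim i : f @: val (rim i) = [set Some (g i); Some (g (i + 1))].
  by rewrite val_rim imset_set2 !gP.
have ind (h : 'I_n -> 'I_n) d : (forall i, h (i + 1) = h i + d) ->
    forall i (p : nat), h (i + p%:R) = h i + d *+ p.
  move=> hS i; elim=> [|p IHp]; first by rewrite !addr0.
  by rewrite -natr1 addrA hS IHp mulrSr addrA.
case: gS => gS.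
  exists g => [i|]; first by rewrite -s'rim; apply: fst; rewrite frim gS.
  left=> i j; rewrite -{1}(subrKC j i) -(natr_Zp (i - j)) (ind _ _ gS).
  by rewrite addrC addKr.
(* A reflection reverses the rim, so the image of [rim i] starts at the image of its far end
   [i + 1]. *)
exists (fun i => g (i + 1)) => [i|].
  by rewrite -s'rim; apply: fst; rewrite frim val_rim -gS setUC.
have gN i : g (i + 1) = g i + -1 by rewrite (gS i) addrK.
right=> i j; rewrite !gN -{1}(subrKC j i) -(natr_Zp (i - j)) (ind _ _ gN).
by rewrite mulNrn natr_Zp; ring.
Qed.

(** Rotations alone suffice to bring a marked pair into standard position. *)
Lemma isomorphic_rotation s t d :
    rim_signed s -> rim_signed t -> (forall i, t (rim (i + d)) = s (rim i)) ->
  isomorphic s t.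
Proof.
move=> /rim_signedP s0 /rim_signedP t0 ts.
pose f (x : wheel_vertex n) := omap (+%R^~ d) x.
have finj : injective f.
  exact/inj_omap/addIr.
have fspoke i : perm finj @: val (spoke i) = val (spoke (i + d)).
  by rewrite /= imset_set2 !permE.
have frim i : perm finj @: val (rim i) = val (rim (i + d)).
  by rewrite /= imset_set2 !permE /= addrAC.
apply/isomorphicP; exists (perm finj).
  rewrite /graph_automorphism eqEcard card_imset ?leqnn ?andbT; last exact/imset_inj/perm_inj.
  apply/subsetP=> _ /imsetP[e eE ->].
  case: (wheel_edgeP (exist (fun A => A \in wheel n) e eE)) => -[i /(congr1 val)/= ->].
    by rewrite fspoke; exact: valP.
  by rewrite frim; exact: valP.
move=> e e'; case: (wheel_edgeP e) => -[i ->].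
  by rewrite fspoke => /val_inj->; rewrite s0 t0.
by rewrite frim => /val_inj->.
Qed.

(* The negative rim edges for [b = false], the positive ones for [b = true]:
   a pair in both cases [p = 2] and [p = n - 2]. *)
Definition marked_rim b s : {set 'I_n} := [set i | s (rim i) (+) b].

(** * Marked pairs and their representatives by cyclic distance *)

Lemma card_negative_edges s :
  rim_signed s -> #|negative_edges s| = #|marked_rim false s|.
Proof.
move=> /rim_signedP s0; rewrite -(card_imset _ rim_inj); apply: eq_card => e.
rewrite inE; apply/idP/imsetP=> [|[i]]; last by rewrite inE addbF => si ->.
case: (wheel_edgeP e) => -[i ->]; rewrite ?s0 // => si.
by exists i; rewrite // inE addbF.
Qed.

Lemma mem_rim_signed_wheels b s :
  (s \in rim_signed_wheels (if b then n - 2 else 2)%N n)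
    = rim_signed s && (#|marked_rim b s| == 2).
Proof.
rewrite inE; case: (boolP (rim_signed s)) => //= s0; rewrite card_negative_edges //.
case: b => //; have -> : marked_rim true s = ~: marked_rim false s.
  by apply/setP=> i; rewrite !inE addbF addbT.
have := cardsC (marked_rim false s); rewrite card_ord /n. move: #|~: _| #|_| => x y cE; apply/eqP/eqP; lia.
Qed.

(** Index [k] stands for cyclic distance [k.+1]. Spokes get [false] for either [b], since the xor
    with [b] is confined to rim edges. *)
Definition pair_signature b k : signature (wheel n) :=
  [ffun e => [exists i : 'I_n,
    (e == rim i) && ((i \in [set (0 : 'I_n); inord k.+1]) (+) b)]].

Lemma pair_signature_rim b k i :
  pair_signature b k (rim i) = (i \in [set (0 : 'I_n); inord k.+1]) (+) b.
Proof.
rewrite ffunE; apply/existsP/idP=> [[j /andP[/eqP/rim_inj->]] //|iP].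
by exists i; rewrite eqxx.
Qed.

Lemma marked_pair_signature b k :
  marked_rim b (pair_signature b k) = [set (0 : 'I_n); inord k.+1].
Proof. by apply/setP=> i; rewrite inE pair_signature_rim addbK. Qed.

Lemma rim_signed_pair_signature b k : rim_signed (pair_signature b k).
Proof.
apply/rim_signedP=> i; rewrite ffunE; apply/existsP=> -[j /andP[/eqP/(congr1 val)]].
by case/eq_set2=> -[].
Qed.

Lemma val_inord_half k : (inord k.+1 : 'I_n) = k.+1 :> nat.
Proof. by rewrite inordK // /n; have := ltn_ord k; rewrite /n; lia. Qed.

Lemma inord_half_neq0 k : (inord k.+1 : 'I_n) <> 0.
Proof. by move/(congr1 val); rewrite [LHS]val_inord_half. Qed.

(** The index map [g] preserves the marked pair and differences up to sign, so [k.+1] and [l.+1]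
    agree up to sign mod [n]; both being at most [n./2], they are equal. *)
Lemma pair_signature_inj b k l :
  switching_isomorphic (pair_signature b k) (pair_signature b l) -> k = l.
Proof.
case/switching_isomorphic_rim; rewrite ?rim_signed_pair_signature // => g gP gD.
have gin i : i \in [set (0 : 'I_n); inord k.+1] -> g i \in [set (0 : 'I_n); inord l.+1].
  by have := gP i; rewrite !pair_signature_rim => /addIb->.
have := gin _ (set21 _ _); have := gin _ (set22 _ _).
have K := val_inord_half k; have L := val_inord_half l.
have kl : (inord k.+1 : 'I_n) = inord l.+1 \/ (inord k.+1 : 'I_n) = - inord l.+1 -> k = l.
  have := ltn_ord k; have := ltn_ord l => ln kn.
  case=> /(congr1 val); rewrite [LHS]K => E; apply: val_inj => /=.
    by move: E; rewrite [RHS]L => -[].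
  have {}E : k.+1 = ((m.+4 - l.+1) %% m.+4)%N by rewrite E -{2}L.
  apply: half_sub_eq kn ln _; rewrite E modn_small //; lia.
have nz := @inord_half_neq0 k.
have gg : g (inord k.+1) - g 0 = inord k.+1 \/ g (inord k.+1) - g 0 = - inord k.+1.
  by case: gD => ->; rewrite ?subr0 ?sub0r; auto.
(* If both marked indices had the same image, their difference would vanish, contrary to [nz]; the
   two other cases reduce to [kl]. *)
rewrite !inE => /orP[]/eqP gk /orP[]/eqP g0; move: gg; rewrite gk g0 ?subrr ?subr0 ?sub0r => gg; apply: kl.
- by case: gg => /esym // /eqP; rewrite oppr_eq0 => /eqP.
- case: gg => [<-|/oppr_inj->]; auto.
- by case: gg => [<-|->]; rewrite ?opprK; auto.
by case: gg => /esym // /eqP; rewrite oppr_eq0 => /eqP.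
Qed.

Lemma pair_signature_cover b s : rim_signed s -> #|marked_rim b s| = 2 ->
  exists k, isomorphic s (pair_signature b k).
Proof.
move=> s0 /eqP/cards2P[i [j [ij sE]]].
(* The residues [j - i] and [i - j] add up to [n], so one of them is at most [n./2]. *)
wlog le_ij : i j ij sE / ((j - i)%R <= n./2)%N => [W|].
  case: (leqP ((j - i)%R) n./2) => [|lt]; first exact: W.
  apply: (W j i); rewrite 1?eq_sym 1?setUC //.
  have -> : (i - j : 'I_n) = (n - (j - i)%R) %% n :> nat by rewrite -opprB.
  by move: (j - i) lt => d; rewrite /n => lt; rewrite modn_small; lia.
have ji0 : (0 < (j - i)%R)%N.
  by rewrite lt0n; apply: contra ij => /eqP E; rewrite eq_sym -subr_eq0; apply/eqP/val_inj.
(* The predecessor enters because index [k] encodes distance [k.+1]; rotation by [- i] then moves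
   the pair to [0] and [j - i]. *)
have kP : ((j - i)%R.-1 < n./2)%N by lia.
exists (Ordinal kP); apply: (isomorphic_rotation (d := - i)) => // [|x].
  exact: rim_signed_pair_signature.
rewrite pair_signature_rim.
have -> : inord (Ordinal kP).+1 = j - i.
  by rewrite -[RHS]inord_val; congr inord; exact: prednK.
rewrite !inE subr_eq0.
rewrite (inj_eq (addIr _)).
have : (x \in marked_rim b s) = (x \in [set i; j]) by rewrite sE.
by rewrite !inE => <-; rewrite addbK.
Qed.

Lemma psi_pair b : psi (if b then n - 2 else 2)%N n = n./2.
Proof.
rewrite -[RHS]card_ord; apply: (@card_equivalence_partition_repr _ _ _ _ (pair_signature b)).
- exact: switching_isomorphic_equivalence.
- move=> k; rewrite mem_rim_signed_wheels rim_signed_pair_signature marked_pair_signature.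
  by rewrite cards2 [0 == _]eq_sym (introF eqP (@inord_half_neq0 k)).
- move=> s; rewrite mem_rim_signed_wheels => /andP[s0 /eqP s2].
  have [k sk] := pair_signature_cover s0 s2.
  by exists k; apply/existsP; exists s; rewrite sk andbT; apply: connect0.
- exact: pair_signature_inj.
Qed.

End Wheel.

Theorem lemma3p3 (n : nat) (hn : 4 <= n) :
  psi 2 n = 1 + (n - 2) %/ 2 /\ psi (n - 2) n = 1 + (n - 2) %/ 2.
Proof.
case: n hn => [|[|[|[|m]]]] // _.
(* What remains is [n./2 = 1 + (n - 2) %/ 2]. *)
by rewrite (psi_pair m false) (psi_pair m true); lia.
Qed.
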